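(* Let $G$ be a finite group and $\Pi$ a compact Lie group. Suppose $V$ is a $\Pi\times G$-representation isomorphic to $n\rho_G\otimes W$, where $\rho_G$ is the real regular representation of $G$, $W$ is an arbitrary finite-dimensional real representation of $\Pi$, and $n\in\mathbb{N}$. Then the $G$-equivariant vector bundle $\lambda_V$ with projection map $E_G\Pi\times_\Pi V\to E_G\Pi\times_\Pi \mathbf{0}=:B_G\Pi$ (induced by the terminal map $V\to\mathbf{0}$) is a homogeneous $G$-equivariant vector bundle.
   Context: $E_G\Pi$ is the total space of the universal principal $G$-$\Pi$-bundle: a $(\Pi\times G)$-space such that for a subgroup $\Lambda\subset\Pi\times G$ the fixed points $(E_G\Pi)^\Lambda$ are contractible if $\Lambda=\{(\theta(h),h):h\in H\}$ is the graph of a homomorphism $\theta:H\to\Pi$ for some subgroup $H\subset G$, and empty otherwise; $B_G\Pi=E_G\Pi/\Pi$. Homogeneity: a $G$-equivariant real vector bundle $\xi$ over $B$ has a classifying map $f_\xi:B\to\Omega^\infty_Gko_G$, where $ko_G$ is genuine $G$-equivariant connective real $K$-theory, with $\underline{\pi}_0ko_G=\underline{RO}_G$ (value $RO(H)$ at $G/H$). For a $G$-space $X$, $\underline{\pi}_0(X)$ is the functor $\mathcal{O}_G^{op}\to\mathrm{Set}$, $G/H\mapsto\pi_0(X^H)$. The bundle $\xi$ is homogeneous if $\underline{\pi}_0(f_\xi):\underline{\pi}_0(B)\to\underline{RO}_G$ factors through a map from the terminal $\mathcal{O}_G$-set (value a point at every $G/H$) to $\underline{RO}_G$. Equivalently,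 there is a class $p_G\in RO(G)$ such that for all subgroups $H\subset G$ and all $b\in B^H$, the fiber $\xi_b$, as an $H$-representation, represents $\mathrm{Res}^G_H(p_G)\in RO(H)$. *)

(* Defs.v *)
From HB Require Import structures.
From mathcomp Require Import all_boot all_order all_algebra all_fingroup.
From mathcomp Require Import all_character.
From mathcomp Require Import mxtens.
From mathcomp Require Import all_classical all_reals all_analysis.

Set Implicit Arguments.
Unset Strict Implicit.
Unset Printing Implicit Defensive.

Import Order.TTheory GRing.Theory Num.Theory.
Import numFieldNormedType.Exports.

Local Open Scope classical_set_scope.
Local Open Scope ring_scope.
Local Open Scope quotient_scope.

(* fingroup also defines a repr. *)
Local Notation repr := generic_quotient.repr.

Definition homeo_on (X Y : topologicalType) (A : set X) (B : set Y)
    (f : X -> Y) (g : Y -> X) : Prop :=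
  [/\ {within A, continuous f}, {within B, continuous g},
      (forall x, A x -> B (f x) /\ g (f x) = x) &
      (forall y, B y -> A (g y) /\ f (g y) = y)].

(* In particular a contractible set is nonempty. *)
Definition contractible (R : realType) (X : topologicalType) (A : set X) :=
  exists2 a, A a & exists F : X * R -> X,
    [/\ {within A `*` `[0, 1], continuous F},
        (forall x t, A x -> 0 <= t <= 1 -> A (F (x, t))),
        (forall x, A x -> F (x, 0) = x) &
        (forall x, A x -> F (x, 1) = a)].

HB.mixin Record isTopologicalGroup T of monoid.Group T & Topological T := {
  mulg_continuous : continuous (fun z : T * T => (z.1 * z.2)%g);
  invg_continuous : continuous (fun x : T => (x^-1)%g)
}.

#[short(type="topGroupType")]
HB.structure Definition TopologicalGroup :=
  {T of monoid.Group T & Topological T & isTopologicalGroup T}.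

Section Smooth.
Variable R : realType.

(* For U open: the partial derivatives of f of order at most k exist and are
   continuous on U. *)
Fixpoint class_C (k : nat) (m : nat) (U : set 'rV[R]_m) (f : 'rV[R]_m -> R^o)
    : Prop :=
  {in U, continuous f} /\
  if k is k'.+1 then
    forall i : 'I_m, {in U, forall x, derivable f x (delta_mx 0 i)} /\
                     class_C k' U ('D_(delta_mx 0 i) f)
  else True.

Definition smooth_on (m n : nat) (U : set 'rV[R]_m)
    (f : 'rV[R]_m -> 'rV[R]_n) : Prop :=
  forall (k : nat) (j : 'I_n), class_C k U (fun x => f x 0 j).

End Smooth.

Section LieGroup.
Variables (R : realType) (Pi : topGroupType).

(* A chart is a homeomorphism from the open set [cdom] onto the open set
   [cimg]; outside these sets the values of [cmap] and [cinv] are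
   meaningless. *)
Record chart (m : nat) := Chart {
  cdom : set Pi;
  cimg : set 'rV[R]_m;
  cmap : Pi -> 'rV[R]_m;
  cinv : 'rV[R]_m -> Pi;
  cdom_open : open cdom;
  cimg_open : open cimg;
  chart_homeo : homeo_on cdom cimg cmap cinv }.

Definition smooth_atlas (m : nat) (atlas : set (chart m)) : Prop :=
  (forall x, exists2 c, atlas c & cdom c x) /\
  (forall c c', atlas c -> atlas c' ->
     smooth_on (cimg c `&` cinv c @^-1` cdom c') (cmap c' \o cinv c)).

(* Multiplication is read in the product charts, with values in
   R^m x R^m = R^(m + m). *)
Definition smooth_mul (m : nat) (atlas : set (chart m)) : Prop :=
  forall c1 c2 c3, atlas c1 -> atlas c2 -> atlas c3 ->
  let mul (z : 'rV[R]_(m + m)) := (cinv c1 (lsubmx z) * cinv c2 (rsubmx z))%g in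
  smooth_on [set z | [/\ cimg c1 (lsubmx z), cimg c2 (rsubmx z)
                       & cdom c3 (mul z)]]
    (cmap c3 \o mul).

Definition smooth_inv (m : nat) (atlas : set (chart m)) : Prop :=
  forall c1 c2, atlas c1 -> atlas c2 ->
  let inv z := ((cinv c1 z)^-1)%g in
  smooth_on (cimg c1 `&` inv @^-1` cdom c2) (cmap c2 \o inv).

(* Second countability is automatic for a compact manifold. *)
Definition compact_Lie_group : Prop :=
  [/\ hausdorff_space Pi, compact [set: Pi] &
      exists m : nat, exists atlas : set (chart m),
        [/\ smooth_atlas atlas, smooth_mul atlas & smooth_inv atlas]].

End LieGroup.

Record group_action (Gam : groupType) (X : Type) := GroupAction {
  gact :> Gam -> X -> X;
  gact1 : forall x, gact 1%g x = x;
  gactM : forall a b x, gact (a * b)%g x = gact a (gact b x) }.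

Definition fixed_points (Gam : groupType) (X : Type) (A : group_action Gam X)
    (L : set Gam) : set X :=
  [set x | forall a, L a -> A a x = x].

Section Orbits.
Variables (Pi : groupType) (G : groupType).

Section Choice.
Variables (X : choiceType) (A : group_action (Pi * G)%type X).

Definition in_orbit : rel X := fun x y => `[< exists p : Pi, A (p, 1%g) x = y >].

Lemma in_orbit_refl : reflexive in_orbit.
Proof. by move=> x; apply/asboolP; exists 1%g; rewrite gact1. Qed.

Lemma in_orbit_sym : symmetric in_orbit.
Proof.
suff H x y : in_orbit x y -> in_orbit y x by move=> x y; apply/idP/idP; exact: H.
move=> /asboolP[p <-]; apply/asboolP; exists (p^-1)%g.
rewrite -gactM -[RHS](gact1 A).
by congr (A _ x); congr pair; rewrite ?mulVg ?mulg1.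
Qed.

Lemma in_orbit_trans : transitive in_orbit.
Proof.
move=> y x z /asboolP[p <-] /asboolP[q <-]; apply/asboolP; exists (q * p)%g.
by rewrite -gactM; congr (A _ x); congr pair; rewrite mulg1.
Qed.

Definition orbit_equiv : equiv_rel X :=
  EquivRel in_orbit in_orbit_refl in_orbit_sym in_orbit_trans.

End Choice.

Section Top.
Variables (X : topologicalType) (A : group_action (Pi * G)%type X).

(* X / Pi, with the quotient topology. *)
Definition orbit_space : topologicalType :=
  quotient_topology {eq_quot (orbit_equiv A)}.

Definition orbit_map (x : X) : orbit_space := \pi_orbit_space x.

Lemma orbit_mapP x y :
  orbit_map x = orbit_map y <-> exists p : Pi, A (p, 1%g) x = y.
Proof.
split=> [xy|xy]; first by apply/asboolP/(@eqmodP _ (orbit_equiv A)).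
by apply/(@eqmodP _ (orbit_equiv A))/asboolP.
Qed.

Lemma repr_orbit_map (b : orbit_space) : orbit_map (repr b) = b.
Proof. exact: reprK. Qed.

Definition residual_act (g : G) (b : orbit_space) : orbit_space :=
  orbit_map (A (1%g, g) (repr b)).

Lemma residual_actE g x : residual_act g (orbit_map x) = orbit_map (A (1%g, g) x).
Proof.
have /orbit_mapP[p px] : orbit_map x = orbit_map (repr (orbit_map x)).
  by rewrite repr_orbit_map.
rewrite /residual_act -px; apply/esym/orbit_mapP; exists p; rewrite -!gactM.
by congr (A _ x); congr pair; rewrite ?mulg1 ?mul1g.
Qed.

Lemma residual_act1 b : residual_act 1%g b = b.
Proof. by rewrite /residual_act gact1 repr_orbit_map. Qed.

Lemma residual_actM g h b :
  residual_act (g * h)%g b = residual_act g (residual_act h b).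
Proof.
rewrite -(repr_orbit_map b) !residual_actE -gactM.
by congr (orbit_map (A _ _)); congr pair; rewrite mulg1.
Qed.

Definition residual_action : group_action G orbit_space :=
  GroupAction residual_act1 residual_actM.

End Top.
End Orbits.

Section Representations.
Variable R : realType.

(* Group elements act on column vectors by left multiplication. *)
Record linear_rep (Gam : groupType) (d : nat) := LinearRep {
  rep_mx :> Gam -> 'M[R]_d;
  rep_mx1 : rep_mx 1%g = 1%:M;
  rep_mxM : forall a b, rep_mx (a * b)%g = rep_mx a *m rep_mx b }.

Definition isomorphic_reps (Gam : groupType) (d e : nat)
    (V : linear_rep Gam d) (V' : linear_rep Gam e) : Prop :=
  exists (f : 'M[R]_(e, d)) (f' : 'M[R]_(d, e)),
    [/\ f *m f' = 1%:M, f' *m f = 1%:M & forall a, f *m V a = V' a *m f].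

Definition continuous_rep (Pi : topGroupType) (d : nat)
    (W : linear_rep Pi d) : Prop := continuous (W : Pi -> 'M[R]_d).

(* The finite group G is discrete, so that continuity on Pi x G is continuity
   on each Pi x {g}. *)
Definition continuous_prod_rep (Pi : topGroupType) (G : finGroupType) (d : nat)
    (V : linear_rep (Pi * G)%type d) : Prop :=
  forall g : G, continuous (fun p : Pi => V (p, g)).

Section Tensor.
Variables (Pi : groupType) (G : finGroupType).
Variables (S : representation R [set: G]%G) (w : nat) (W : linear_rep Pi w).

Definition tensor_mx (a : Pi * G) : 'M[R]_(rdegree S * w) := S a.2 *t W a.1.

Lemma tensor_mx1 : tensor_mx 1%g = 1%:M.
Proof.
rewrite -[LHS]/(S 1%g *t W 1%g) repr_mx1 rep_mx1.
apply/matrixP=> i j; case: (mxtens_indexP i) => i1 i2.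
case: (mxtens_indexP j) => j1 j2; rewrite tensmxE !mxE -natrM mulnb.
by rewrite (can_eq (@mxtens_indexK _ _)) xpair_eqE.
Qed.

Lemma tensor_mxM a b : tensor_mx (a * b)%g = tensor_mx a *m tensor_mx b.
Proof. rewrite -[LHS]/(S (a.2 * b.2)%g *t W (a.1 * b.1)%g) repr_mxM ?inE // rep_mxM.
by rewrite tensmx_mul. Qed.

(* The (Pi x G)-representation S (x) W. *)
Definition tensor_rep : linear_rep (Pi * G)%type (rdegree S * w) :=
  LinearRep tensor_mx1 tensor_mxM.

End Tensor.

(* n rho_G *)
Definition regular_multiple (G : finGroupType) (n : nat) :
    representation R [set: G]%G :=
  muln_grepr (Representation (regular_repr R [set: G]%G)) n.

End Representations.

(* RO(H) is the Grothendieck group of the monoid of isomorphism classes of real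
   H-representations under direct sum; only its underlying set and the
   restriction maps are needed. *)
Section RealRepresentationRing.
Variables (R : realType) (G : finGroupType).

HB.instance Definition _ (H : {group G}) := gen_eqMixin (representation R H).
HB.instance Definition _ (H : {group G}) := gen_choiceMixin (representation R H).

Section IsoClasses.
Variable H : {group G}.
Implicit Types P Q S : representation R H.

Definition rsim : rel (representation R H) := fun P Q => `[< mx_rsim P Q >].

Lemma rsim_refl : reflexive rsim.
Proof. by move=> P; apply/asboolP; exact: mx_rsim_refl. Qed.

Lemma rsim_sym : symmetric rsim.
Proof. by move=> P Q; apply: asbool_equiv_eq; split=> /mx_rsim_sym. Qed.

Lemma rsim_trans : transitive rsim.
Proof.
move=> Q P S /asboolP PQ /asboolP QS; apply/asboolP; exact: mx_rsim_trans QS.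
Qed.

Definition rsim_equiv : equiv_rel (representation R H) :=
  EquivRel rsim rsim_refl rsim_sym rsim_trans.

Definition rep_class : Type := {eq_quot rsim_equiv}.
HB.instance Definition _ := Choice.on rep_class.

Definition class_of P : rep_class := \pi_({eq_quot rsim_equiv}) P.
Definition class_repr (x : rep_class) : representation R H :=
  repr (x : {eq_quot rsim_equiv}).

Lemma class_reprK x : class_of (class_repr x) = x. Proof. exact: reprK. Qed.

Lemma class_ofP P Q : class_of P = class_of Q <-> mx_rsim P Q.
Proof.
by split=> [/(@eqmodP _ rsim_equiv)/asboolP|?] //;
   apply/(@eqmodP _ rsim_equiv)/asboolP.
Qed.

Definition class_add (x y : rep_class) : rep_class :=
  class_of (dadd_grepr (class_repr x) (class_repr y)).

Lemma mx_rsim_daddl P P' Q Q' : mx_rsim P P' -> mx_rsim Q Q' ->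
  mx_rsim (dadd_grepr P Q) (dadd_grepr P' Q').
Proof.
move=> [B eB fB hB] [C eC fC hC]; exists (block_mx B 0 0 C).
- by rewrite /= eB eC.
- rewrite /row_free rank_diag_block_mx.
  by rewrite /row_free in fB fC; rewrite (eqP fB) (eqP fC).
- move=> x Hx /=; rewrite !mulmx_block !(mulmx0, mul0mx, addr0, add0r).
  by rewrite hB // hC.
Qed.

Lemma class_addE P Q :
  class_add (class_of P) (class_of Q) = class_of (dadd_grepr P Q).
Proof. by apply/class_ofP/mx_rsim_daddl; apply/class_ofP; rewrite class_reprK. Qed.

Lemma class_addC : commutative class_add.
Proof.
move=> x y; rewrite -(class_reprK x) -(class_reprK y) !class_addE.
set P := class_repr x; set Q := class_repr y; apply/class_ofP.
exists (block_mx 0 1%:M 1%:M 0).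
- exact: addnC.
- apply/row_freeP; exists (block_mx 0 1%:M 1%:M 0).
  rewrite mulmx_block !(mulmx0, mul0mx, mulmx1, addr0, add0r).
  by rewrite -scalar_mx_block.
- move=> g Hg /=; rewrite !mulmx_block.
  by rewrite !(mulmx0, mul0mx, mulmx1, mul1mx, addr0, add0r).
Qed.

Lemma mx_rsim_cast P Q (e : rdegree P = rdegree Q) :
  {in H, forall g, Q g = castmx (e, e) (P g)} -> mx_rsim P Q.
Proof.
case: P Q e => [n P] [n' Q] /= e; case: _ / e Q => Q PQ; exists 1%:M => //.
  by rewrite /row_free mxrank1.
by move=> g Hg; rewrite PQ // castmx_id mulmx1 mul1mx.
Qed.

Lemma class_addA : associative class_add.
Proof.
move=> x y z; rewrite -(class_reprK x) -(class_reprK y) -(class_reprK z).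
rewrite !class_addE; set P := class_repr x; set Q := class_repr y.
set S := class_repr z; apply/class_ofP.
pose e := addnA (rdegree P) (rdegree Q) (rdegree S).
apply: (@mx_rsim_cast (dadd_grepr P (dadd_grepr Q S))
                      (dadd_grepr (dadd_grepr P Q) S) e) => g _ /=.
have := @block_mxA _ _ _ _ _ _ _ (P g) 0 0 0 (Q g) 0 0 0 (S g).
rewrite /= !row_mx0 !col_mx0 => ->; exact: (esym (castmxKV _ _ _)).
Qed.

Lemma class_add0 : left_id (class_of grepr0) class_add.
Proof.
move=> x; rewrite -(class_reprK x) class_addE; apply/class_ofP.
exists 1%:M => //; first by rewrite /row_free mxrank1.
move=> g Hg /=; rewrite mulmx1 mul1mx; apply/matrixP=> i j.
rewrite !mxE; case: splitP => [[]//|i' ii']; rewrite mxE.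
case: splitP => [[]//|j' jj']; congr (_ _ _); exact/val_inj.
Qed.

HB.instance Definition _ :=
  GRing.isNmodule.Build rep_class class_addA class_addC class_add0.

Definition groth_rel : rel (rep_class * rep_class) := fun x y =>
  `[< exists k : rep_class, x.1 + y.2 + k = y.1 + x.2 + k >].

Lemma groth_refl : reflexive groth_rel.
Proof. by move=> x; apply/asboolP; exists 0. Qed.

Lemma groth_sym : symmetric groth_rel.
Proof. by move=> x y; apply: asbool_equiv_eq; split=> -[k e]; exists k. Qed.

Lemma groth_trans : transitive groth_rel.
Proof.
move=> y x z /asboolP[k xy] /asboolP[l yz]; apply/asboolP.
exists (y.1 + y.2 + k + l).
have -> : x.1 + z.2 + (y.1 + y.2 + k + l) = (x.1 + y.2 + k) + (y.1 + z.2 + l).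
  by rewrite !addrA [LHS](AC 6 (1*4*5*3*2*6)).
by rewrite xy yz !addrA [LHS](AC 6 (4*2*1*5*3*6)).
Qed.

Definition groth_equiv : equiv_rel (rep_class * rep_class)%type :=
  EquivRel groth_rel groth_refl groth_sym groth_trans.

Definition RO : Type := {eq_quot groth_equiv}.

Definition RO_diff (x y : rep_class) : RO := \pi_({eq_quot groth_equiv}) (x, y).
Definition RO_repr (x : RO) : rep_class * rep_class :=
  repr (x : {eq_quot groth_equiv}).

Lemma RO_reprK x : RO_diff (RO_repr x).1 (RO_repr x).2 = x.
Proof. by rewrite /RO_diff -surjective_pairing; exact: reprK. Qed.

Lemma RO_diffP x y x' y' : RO_diff x y = RO_diff x' y' <->
  exists k : rep_class, x + y' + k = x' + y + k.
Proof.
by split=> [/(@eqmodP _ groth_equiv)/asboolP|?] //;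
   apply/(@eqmodP _ groth_equiv)/asboolP.
Qed.

Definition RO_class (n : nat) (rho : mx_representation R H n) : RO :=
  RO_diff (class_of (Representation rho)) 0.

End IsoClasses.

Section Restriction.
Variable H : {group G}.

Definition res_repr (P : representation R [set: G]%G) : representation R H :=
  Representation (subg_repr P (finset.subsetT H)).

Definition res_class (x : rep_class [set: G]%G) : rep_class H :=
  class_of (res_repr (class_repr x)).

Lemma res_classE P : res_class (class_of P) = class_of (res_repr P).
Proof.
apply/class_ofP; have /class_ofP[B eB fB hB] := class_reprK (class_of P).
by exists B => // g _; apply: hB; rewrite inE.
Qed.

Lemma res_classD x y : res_class (x + y) = res_class x + res_class y.
Proof.
rewrite -(class_reprK x) -(class_reprK y) [class_of _ + _]class_addE !res_classE.
rewrite [RHS]class_addE; apply/class_ofP; exists 1%:M => //.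
  by rewrite /row_free mxrank1.
by move=> g _; rewrite mulmx1 mul1mx.
Qed.

Definition RO_res (x : RO [set: G]%G) : RO H :=
  RO_diff (res_class (RO_repr x).1) (res_class (RO_repr x).2).

Lemma RO_resE x y : RO_res (RO_diff x y) = RO_diff (res_class x) (res_class y).
Proof.
have /RO_diffP[k e] := RO_reprK (RO_diff x y).
by apply/RO_diffP; exists (res_class k); rewrite -!res_classD e.
Qed.

End Restriction.
End RealRepresentationRing.

Section VectorBundles.
Variables (R : realType) (G : finGroupType).

(* [vadd x y] is only meaningful for x and y in the same fiber. *)
Record eqvt_bundle := EqvtBundle {
  base : topologicalType;
  total : topologicalType;
  proj : total -> base;
  vadd : total -> total -> total;
  vscale : R -> total -> total;
  base_act : group_action G base;
  total_act : group_action G total }.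

(* As vadd and vscale are carried by the local trivializations to the operations
   of R^k, they satisfy the axioms of a vector space on each fiber. *)
Definition locally_trivial (xi : eqvt_bundle) : Prop :=
  forall b : base xi, exists U : set (base xi), exists k : nat,
  exists phi : total xi -> base xi * 'cV[R]_k,
  exists psi : base xi * 'cV[R]_k -> total xi,
    [/\ open U, U b,
        homeo_on (@proj xi @^-1` U) (U `*` setT) phi psi &
        forall x, U (proj x) ->
          [/\ (phi x).1 = proj x,
              (forall y, proj y = proj x -> proj (vadd x y) = proj x /\
                 (phi (vadd x y)).2 = (phi x).2 + (phi y).2) &
              (forall c, proj (vscale c x) = proj x /\
                 (phi (vscale c x)).2 = c *: (phi x).2)]].

Definition is_eqvt_vector_bundle (xi : eqvt_bundle) : Prop :=
  [/\ continuous (@proj xi),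
      locally_trivial xi,
      (forall g, continuous (base_act xi g)) /\
      (forall g, continuous (total_act xi g)),
      (forall g x, proj (total_act xi g x) = base_act xi g (proj x)) &
      (forall g x y, proj x = proj y ->
         total_act xi g (vadd x y) = vadd (total_act xi g x) (total_act xi g y)) /\
      (forall g c x, total_act xi g (vscale c x) = vscale c (total_act xi g x))].

(* For b fixed by H, the fiber over b is isomorphic to rho as an
   H-representation. *)
Definition fiber_iso (xi : eqvt_bundle) (b : base xi) (H : {group G}) (m : nat)
    (rho : mx_representation R H m) : Prop :=
  exists f : 'cV[R]_m -> total xi,
    [/\ set_bij setT (@proj xi @^-1` [set b]) f,
        (forall u v, f (u + v) = vadd (f u) (f v)),
        (forall c u, f (c *: u) = vscale c (f u)) &
        (forall h u, h \in H -> f (rho h *m u) = total_act xi h (f u))].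

Definition homogeneous (xi : eqvt_bundle) : Prop :=
  exists p : RO R [set: G]%G, forall (H : {group G}) (b : base xi),
    (fixed_points (base_act xi) [set` H]) b ->
    exists m : nat, exists rho : mx_representation R H m,
      fiber_iso b rho /\ RO_class rho = RO_res H p.

End VectorBundles.

Section UniversalBundle.
Variables (R : realType) (Pi : topGroupType) (G : finGroupType).

Definition continuous_action (E : topologicalType)
    (A : group_action (Pi * G)%type E) : Prop :=
  forall g : G, continuous (fun z : Pi * E => A (z.1, g) z.2).

(* Both groups act on the left, and a bundle isomorphism over U carries the
   action of Pi to left translation on U x Pi. *)
Definition principal_bundle (E : topologicalType)
    (A : group_action (Pi * G)%type E) : Prop :=
  continuous_action A /\
  forall b : orbit_space A, exists U : set (orbit_space A),
  exists phi : E -> orbit_space A * Pi, exists psi : orbit_space A * Pi -> E,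
    [/\ open U, U b,
        homeo_on (@orbit_map _ _ _ A @^-1` U) (U `*` setT) phi psi &
        forall e, U (orbit_map A e) ->
          (phi e).1 = orbit_map A e /\
          forall p, (phi (A (p, 1%g) e)).2 = (p * (phi e).2)%g].

Definition is_subgroup (L : set (Pi * G)) : Prop :=
  L 1%g /\ forall a b, L a -> L b -> L (a * b^-1)%g.

Definition is_hom_graph (L : set (Pi * G)) : Prop :=
  exists (H : {group G}) (theta : G -> Pi),
    {in H &, {morph theta : x y / (x * y)%g >-> (x * y)%g}} /\
    L = [set (theta h, h) | h in [set` H]].

Definition universal_principal_bundle (E : topologicalType)
    (A : group_action (Pi * G)%type E) : Prop :=
  [/\ principal_bundle A,
      (forall L, is_subgroup L -> is_hom_graph L ->
         contractible R (fixed_points A L)) &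
      (forall L, is_subgroup L -> ~ is_hom_graph L -> fixed_points A L = set0)].

Section Lambda.
Variables (E : topologicalType) (A : group_action (Pi * G)%type E).
Variables (d : nat) (V : linear_rep R (Pi * G)%type d).

Definition diag_act (a : Pi * G) (x : E * 'cV[R]_d) : E * 'cV[R]_d :=
  (A a x.1, V a *m x.2).

Lemma diag_act1 x : diag_act 1%g x = x.
Proof. by case: x => e v; rewrite /diag_act gact1 rep_mx1 mul1mx. Qed.

Lemma diag_actM a b x : diag_act (a * b)%g x = diag_act a (diag_act b x).
Proof. by rewrite /diag_act gactM rep_mxM mulmxA. Qed.

Definition diag_action : group_action (Pi * G)%type (E * 'cV[R]_d)%type :=
  GroupAction diag_act1 diag_actM.

Definition lambda_total : topologicalType := orbit_space diag_action.

Definition lambda_proj (x : lambda_total) : orbit_space A :=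
  orbit_map A (repr x).1.

(* [e, v] + [e', v'] = [e, v + p v'] where p in Pi is such that p e' = e. *)
Definition lambda_add (x y : lambda_total) : lambda_total :=
  let p := xget 1%g [set p : Pi | A (p, 1%g) (repr y).1 = (repr x).1] in
  orbit_map diag_action
    ((repr x).1, (repr x).2 + V (p, 1%g) *m (repr y).2).

Definition lambda_scale (c : R) (x : lambda_total) : lambda_total :=
  orbit_map diag_action ((repr x).1, c *: (repr x).2).

Definition lambda_bundle : eqvt_bundle R G :=
  EqvtBundle lambda_proj lambda_add lambda_scale
    (residual_action A) (residual_action diag_action).

Lemma lambda_projE e v : lambda_proj (orbit_map diag_action (e, v)) = orbit_map A e.
Proof.
have /orbit_mapP[p [pe _]] := repr_orbit_map (orbit_map diag_action (e, v)).
by apply/orbit_mapP; exists p.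
Qed.

Lemma lambda_scaleE c e v :
  lambda_scale c (orbit_map diag_action (e, v)) = orbit_map diag_action (e, c *: v).
Proof.
have /orbit_mapP[p [pe pv]] := repr_orbit_map (orbit_map diag_action (e, v)).
by apply/orbit_mapP; exists p; rewrite /= /diag_act /= -scalemxAr pe pv.
Qed.

Lemma lambda_addE :
  (forall p e, A (p, 1%g) e = e -> p = 1%g) -> forall e v v',
  lambda_add (orbit_map diag_action (e, v)) (orbit_map diag_action (e, v'))
  = orbit_map diag_action (e, v + v').
Proof.
move=> free e v v'; rewrite /lambda_add.
have /orbit_mapP[p] := repr_orbit_map (orbit_map diag_action (e, v)).
have /orbit_mapP[q] := repr_orbit_map (orbit_map diag_action (e, v')).
case: (repr (orbit_map diag_action (e, v))) => e1 v1.
case: (repr (orbit_map diag_action (e, v'))) => e2 v2 [/= qe qv] [/= pe pv].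
have mulE (a b : Pi) : ((a * b)%g, 1%g) = ((a, 1) * (b, 1))%g :> Pi * G.
  by congr pair; rewrite mulg1.
case: xgetP => [r _ /= rE|/(_ (p^-1 * q)%g)]; last first.
  by case; rewrite /= mulE gactM qe -pe -gactM -mulE mulVg gact1.
apply/orbit_mapP; exists p; rewrite /= /diag_act /= pe mulmxDr pv mulmxA -rep_mxM.
rewrite -mulE; suff -> : (p * r)%g = q by rewrite qv.
apply/(mulIg q^-1%g); rewrite mulgV; apply: (free _ e).
have qV : A (q^-1, 1)%g e = e2 by rewrite -qe -gactM -mulE mulVg gact1.
by rewrite mulE gactM qV mulE gactM rE.
Qed.

End Lambda.
End UniversalBundle.

(* Main.v *)
(* A principal chart over U trivialises lambda_V over U by sending [e, v] to
   ([e], V(p, 1)^-1 v), where p is the Pi-coordinate of e; since orbit maps are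
   open, continuity can be tested before passing to orbits.

   If b = [e] is fixed by H, freeness of the Pi-action gives a unique theta(h)
   with (theta(h), h) e = e, theta is a homomorphism, and the fiber over b is V
   pulled back along (theta, id), that is n rho_G (x) theta^*W.  Restricted to H,
   n rho_G is induced from the trivial group, so tensoring it with any X only
   sees the dimension of X: the fiber is the restriction of n rho_G (x) R^w
   whatever theta is. *)
Require Import Defs.
From mathcomp Require Import all_boot all_order all_algebra all_fingroup.
From mathcomp Require Import all_character mxtens.
From mathcomp Require Import all_classical all_reals all_analysis.

Set Implicit Arguments.
Unset Strict Implicit.
Unset Printing Implicit Defensive.

Import Order.TTheory GRing.Theory Num.Theory.
Import numFieldNormedType.Exports.

Local Open Scope classical_set_scope.
Local Open Scope ring_scope.
Local Open Scope quotient_scope.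

Local Notation qrepr := generic_quotient.repr.

(** * Tensor products of matrices *)

Section TensorBilinear.
Variable R : comPzRingType.

Lemma tensmx_suml (I : finType) m n p q (F : I -> 'M[R]_(m, n)) (B : 'M[R]_(p, q)) :
  (\sum_i F i) *t B = \sum_i (F i *t B).
Proof.
apply/matrixP=> i j; rewrite summxE !mxE summxE mulr_suml.
by apply: eq_bigr => k _; rewrite !mxE.
Qed.

Lemma tens_mx1 m n : (1%:M : 'M[R]_m) *t (1%:M : 'M[R]_n) = 1%:M.
Proof.
apply/matrixP=> i j; case: (mxtens_indexP i) => i1 i2.
case: (mxtens_indexP j) => j1 j2; rewrite tensmxE !mxE -natrM mulnb.
by rewrite (can_eq (@mxtens_indexK _ _)) xpair_eqE.
Qed.

End TensorBilinear.

(** * Systems of imprimitivity and multiples of the regular representation *)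

Section Imprimitivity.
Variables (R : realType) (G : finGroupType).
Implicit Types S : representation R [set: G]%G.

(* A system of imprimitivity for S with the regular G-set as base: it makes S a
   multiple of the regular representation. *)
Definition regular_grading S (P : G -> 'M[R]_(rdegree S)) : Prop :=
  [/\ \sum_g P g = 1%:M,
      forall g g', P g *m P g' = if g == g' then P g else 0 &
      forall g h, S h *m P (g * h)%g = P g *m S h].

(** [P g] is the matrix unit of the basis vector [g]. Row [g] of the matrix of [h] is the basis
    vector [g * h], so both sides of the last identity are the matrix unit at position
    [(g, g * h)]. *)
Lemma regular_grading_regular :
  exists P, @regular_grading (Representation (regular_repr R [set: G]%G)) P.
Proof.
pose ix (g : G) := gring_index [set: G]%G g.
have ixK : cancel ix enum_val by move=> g; apply: gring_indexK; rewrite inE.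
have ixV : cancel enum_val ix by exact: gring_valK.
have ix_bij : {on predT, bijective ix} by exists enum_val => x _.
exists (fun g => delta_mx (ix g) (ix g)); split=> [|g g'|g h] /=.
- rewrite -(reindex ix ix_bij (F := fun i => delta_mx i i)) /=.
  by rewrite mx1_sum_delta.
- rewrite mul_delta_mx_cond (can_eq ixK); case: eqP => [->|] //.
- apply/matrixP=> i j; rewrite !mxE (bigD1 (ix (g * h)%g)) //= big1 => [|k kn].
    rewrite (bigD1 (ix g)) //= big1 => [|k kn]; last first.
      by rewrite !mxE (negPf kn) andbF mul0r.
    rewrite !mxE !eqxx !addr0 ixK /= andbT.
    rewrite -[gring_index _ _]/(ix _) (can_eq ixK) (inj_eq (mulIg h)).
    by rewrite (eq_sym i) (can2_eq ixK ixV).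
  by rewrite !mxE (negPf kn) mulr0.
Qed.

Lemma regular_grading_dadd S T :
  (exists P, @regular_grading S P) -> (exists P, @regular_grading T P) ->
  exists P, @regular_grading (dadd_grepr S T) P.
Proof.
move=> [P [P1 PP PS]] [Q [Q1 QQ QT]].
exists (fun g => block_mx (P g) 0 0 (Q g)); split=> [|g g'|g h] /=.
- transitivity (block_mx (\sum_g P g) 0 0 (\sum_g Q g)).
    apply: (big_rec3 (fun x y z => x = block_mx y 0 0 z)).
      by rewrite block_mx0.
    by move=> g x y z _ ->; rewrite add_block_mx !addr0.
  by rewrite P1 Q1 -scalar_mx_block.
- rewrite mulmx_block !(mulmx0, mul0mx, addr0, add0r) PP QQ.
  by case: ifP => // _; rewrite block_mx0.
- by rewrite !mulmx_block !(mulmx0, mul0mx, addr0, add0r) PS QT.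
Qed.

Lemma regular_grading_multiple n :
  exists P, @regular_grading (regular_multiple R G n) P.
Proof.
rewrite /regular_multiple /muln_grepr.
apply: (big_ind (fun S => exists P, @regular_grading S P)).
(* The empty sum has degree 0, so identities between its matrices hold vacuously. *)
- exists (fun=> 0); split=> *; apply/matrixP=> -[] //.
- exact: regular_grading_dadd.
- by move=> _ _; exact: regular_grading_regular.
Qed.

Section Untwist.
Variables (H : {group G}) (S : representation R [set: G]%G) (w : nat).

Lemma tensor_repr_proof (X : mx_representation R H w) :
  mx_repr H (fun h => S h *t X h).
Proof.
split=> [|h k Hh Hk]; first by rewrite !repr_mx1 tens_mx1.
by rewrite tensmx_mul !repr_mxM ?inE.
Qed.
Definition tensor_repr X := MxRepresentation (tensor_repr_proof X).

Lemma trivial_repr_proof : mx_repr H (fun=> 1%:M : 'M[R]_w).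
Proof. by split=> // h k _ _; rewrite mulmx1. Qed.
Definition trivial_repr := MxRepresentation trivial_repr_proof.

(** The [H]-component of [g] for a transversal of the left cosets. It commutes with right
    translation by [H] and allows [X] to be evaluated along all of [G]. *)
Definition coset_part (g : G) : G := ((repr (g *: H))^-1 * g)%g.

Lemma coset_part_in g : coset_part g \in H.
Proof.
have := mem_repr g (lcoset_refl H g); rewrite /coset_part.
by case/lcosetP=> h Hh ->; rewrite invMg mulgKV groupV.
Qed.

Lemma coset_partM g h : h \in H -> coset_part (g * h)%g = (coset_part g * h)%g.
Proof. by move=> Hh; rewrite /coset_part lcosetM lcoset_id // mulgA. Qed.

(* [X h *m X (coset_part (g * h))^-1 = X (coset_part g)^-1], so twisting the g-th
   summand by X (coset_part g)^-1 intertwines X with the trivial action. *)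
Lemma tensor_repr_untwist (X : mx_representation R H w) P :
  @regular_grading S P -> mx_rsim (tensor_repr X) (tensor_repr trivial_repr).
Proof.
move=> [P1 PP PS].
pose B := \sum_g P g *t X (coset_part g)^-1%g.
pose C := \sum_g P g *t X (coset_part g).
exists B => //.
  apply/row_freeP; exists C; rewrite mulmx_suml -(tens_mx1 _ _ w) -P1 tensmx_suml.
  apply: eq_bigr => g _; rewrite mulmx_sumr (bigD1 g) //= big1 => [|k kg].
    by rewrite tensmx_mul PP eqxx -repr_mxM ?groupV ?coset_part_in // mulVg repr_mx1 addr0.
  by rewrite tensmx_mul PP eq_sym (negPf kg) tens0mx.
move=> h Hh; rewrite mulmx_sumr mulmx_suml (reindex_inj (mulIg h)) /=.
apply: eq_bigr => g _; rewrite !tensmx_mul PS coset_partM // invMg.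
by rewrite -repr_mxM ?groupM ?groupV ?coset_part_in // mulKVg mulmx1.
Qed.

End Untwist.
End Imprimitivity.

(** * Limits in products and in matrix spaces *)

Lemma cvg_pair_nbhs (U W : topologicalType) T (F : set_system T) {FF : Filter F}
    (f : T -> U) (g : T -> W) (a : U) (b : W) :
  f @ F --> a -> g @ F --> b -> (f x, g x) @[x --> F] --> (a, b).
Proof. by move=> fa gb; apply: cvg_pair. Qed.

Lemma open_setXT (U W : topologicalType) (B : set U) :
  open B -> open (B `*` [set: W]).
Proof.
move=> oB; rewrite (_ : _ `*` _ = fst @^-1` B).
  by apply: open_comp => // z _; exact: cvg_fst.
by apply/seteqP; split=> -[u v] //= [].
Qed.

Section MatrixCvg.
Variable R : realType.

(** A basic matrix neighbourhood prescribes one neighbourhood per entry, and a filter is stable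
    under finite intersections. *)
Lemma cvg_mx T (F : set_system T) {FF : Filter F} m n
    (f : T -> 'M[R]_(m, n)) (a : 'M[R]_(m, n)) :
  (forall i j, f x i j @[x --> F] --> a i j) -> f @ F --> a.
Proof.
move=> fa P [Q Qa QP]; rewrite /= nbhs_simpl.
have : \forall x \near F, forall ij : 'I_m * 'I_n, Q ij.1 ij.2 (f x ij.1 ij.2).
  by apply: filter_forall => -[i j]; exact: fa (Qa i j).
by apply: filterS => x Qx; apply: QP => i j; exact: (Qx (i, j)).
Qed.

Lemma cvg_mulmx T (F : set_system T) {FF : Filter F} m n p
    (f : T -> 'M[R]_(m, n)) (g : T -> 'M[R]_(n, p)) (a : 'M[R]_(m, n))
    (b : 'M[R]_(n, p)) :
  f @ F --> a -> g @ F --> b -> f x *m g x @[x --> F] --> a *m b.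
Proof.
move=> fa gb; apply: cvg_mx => i k; rewrite mxE.
under eq_cvg do rewrite mxE.
apply: cvg_big => [|j _]; first exact: add_continuous.
apply: cvgM; first exact: (cvg_comp _ _ fa (@coord_continuous _ _ _ i j a)).
exact: (cvg_comp _ _ gb (@coord_continuous _ _ _ j k b)).
Qed.

End MatrixCvg.

(** * Topology of the orbit space *)

Section Orbits.
Variables (Pi : topGroupType) (G : finGroupType) (X : topologicalType).
Variable A : group_action (Pi * G)%type X.
Hypothesis A_cont : continuous_action A.

Lemma cvg_gact T (F : set_system T) {FF : Filter F} (f : T -> Pi) (h : T -> X)
    g p x : f @ F --> p -> h @ F --> x -> A (f t, g) (h t) @[t --> F] --> A (p, g) x.
Proof.
move=> fp hx; apply: (cvg_comp _ (fun z : Pi * X => A (z.1, g) z.2) (cvg_pair fp hx)).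
exact: (@A_cont g (p, x)).
Qed.

Lemma gact_continuous a : continuous (A a).
Proof.
case: a => p g x.
by apply: (@cvg_gact _ _ _ (fun=> p) id); [exact: cvg_cst | exact: cvg_id].
Qed.

Lemma orbit_map_continuous : continuous (orbit_map A).
Proof. exact: pi_continuous. Qed.

Lemma orbit_map_act p x : orbit_map A (A (p, 1%g) x) = orbit_map A x.
Proof. by apply/esym/orbit_mapP; exists p. Qed.

(** The saturation of [O] is the union of its translates by [Pi], each the preimage of [O] under a
    continuous map. *)
Lemma orbit_map_open (O : set X) : open O -> open (orbit_map A @` O).
Proof.
move=> oO; rewrite /open /= /quotient_open.
have -> : \pi_(orbit_space A) @^-1` (orbit_map A @` O) =
    \bigcup_(p in [set: Pi]) (A (p, 1%g) @^-1` O).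
  apply/seteqP; split=> x /=.
    by case=> y Oy /esym/orbit_mapP[p py]; exists p => //=; rewrite py.
  by case=> p _ /= Op; exists (A (p, 1%g) x) => //; exact: orbit_map_act.
apply: bigcup_open => p _; apply: open_comp => // x _; exact: gact_continuous.
Qed.

(** Openness of [orbit_map] turns neighbourhoods of [x] into neighbourhoods of its orbit. The
    criterion is pointwise, so it also applies to maps continuous over an open part only. *)
Lemma cvg_orbit_space (Z : topologicalType) (f : orbit_space A -> Z) x (l : Z) :
  f (orbit_map A y) @[y --> x] --> l -> f y @[y --> orbit_map A x] --> l.
Proof.
move=> fl P /fl nP.
have [B [oB Bx BP]] : exists B, [/\ open B, B x & forall y, B y -> P (f (orbit_map A y))].
  by move: nP; rewrite /fmap /= nbhsE => -[B [oB Bx] BP]; exists B.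
apply: (@filterS _ (nbhs (orbit_map A x)) _ (orbit_map A @` B)); last first.
  by apply: open_nbhs_nbhs; split; [exact: orbit_map_open|exists x].
by move=> _ [y By <-]; exact: BP.
Qed.

Lemma residual_action_continuous g : continuous (residual_action A g).
Proof.
move=> b; rewrite -(repr_orbit_map b); apply: cvg_orbit_space.
rewrite (_ : (fun y => _) = fun y => orbit_map A (A (1%g, g) y)); last first.
  by apply/funext => y; exact: residual_actE.
rewrite [in X in _ --> X]/residual_action /= residual_actE.
apply: (cvg_comp (A (1%g, g)) (orbit_map A)); first exact: gact_continuous.
exact: orbit_map_continuous.
Qed.

(** A chart turns the action of [Pi] into left translation, which has no fixed points unless
    [p = 1]. *)
Lemma principal_free : principal_bundle A ->
  forall p x, A (p, 1%g) x = x -> p = 1%g.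
Proof.
move=> [_ +] p x px => /(_ (orbit_map A x))[U [phi [_ [_ Ux _ /(_ x Ux)[_ /(_ p)]]]]].
by rewrite px => e; apply: (mulIg (phi x).2); rewrite mul1g.
Qed.

End Orbits.

(** * The vector bundle structure of lambda_V *)

Section LambdaBundle.
Variables (R : realType) (Pi : topGroupType) (G : finGroupType).
Variables (E : topologicalType) (A : group_action (Pi * G)%type E).
Variables (d : nat) (V : linear_rep R (Pi * G)%type d).
Hypothesis A_principal : principal_bundle A.
Hypothesis V_cont : continuous_prod_rep V.

Let A_cont : continuous_action A := proj1 A_principal.
Let free := principal_free A_principal.
Let Q := orbit_map (diag_action A V).

Lemma cvg_rep T (F : set_system T) {FF : Filter F} (f : T -> Pi)
    (u : T -> 'cV[R]_d) g p (v : 'cV[R]_d) :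
  f @ F --> p -> u @ F --> v -> V (f t, g) *m u t @[t --> F] --> V (p, g) *m v.
Proof.
by move=> fp; apply: cvg_mulmx; exact: (cvg_comp _ _ fp (@V_cont g p)).
Qed.

Lemma diag_action_continuous : continuous_action (diag_action A V).
Proof.
move=> g z0.
have c1 : z.1 @[z --> z0] --> z0.1 by exact: cvg_fst.
have c2 : z.2 @[z --> z0] --> z0.2 by exact: cvg_snd.
have c21 : z.2.1 @[z --> z0] --> z0.2.1 by exact: (cvg_comp _ _ c2 cvg_fst).
have c22 : z.2.2 @[z --> z0] --> z0.2.2 by exact: (cvg_comp _ _ c2 cvg_snd).
exact: (cvg_pair_nbhs (cvg_gact A_cont c1 c21) (cvg_rep c1 c22)).
Qed.

Lemma mulg_fst (p q : Pi) : ((p, 1) * (q, 1))%g = (p * q, 1)%g :> (Pi * G)%type.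
Proof. by congr pair; rewrite mulg1. Qed.

(** A representative can be translated by [Pi] until its first coordinate is [e]; vectors in one
    fiber thus get a common base point, as [lambda_addE] requires. *)
Lemma orbit_map_in_fiber e x : lambda_proj x = orbit_map A e -> exists v, x = Q (e, v).
Proof.
rewrite -(repr_orbit_map x); case: (qrepr x) => e' v'; rewrite lambda_projE.
move=> /orbit_mapP[p pe]; exists (V (p, 1%g) *m v').
by apply/orbit_mapP; exists p; rewrite /= /diag_act /= pe.
Qed.

Lemma lambda_proj_continuous : continuous (@lambda_proj _ _ _ _ A _ V).
Proof.
move=> x; rewrite -(repr_orbit_map x).
apply: (cvg_orbit_space diag_action_continuous).
case: (qrepr x) => e v; rewrite lambda_projE.
rewrite (_ : (fun y => _) = fun y => orbit_map A y.1); last first.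
  by apply/funext => -[e' v']; exact: lambda_projE.
apply: (cvg_comp fst (orbit_map A)); first exact: cvg_fst.
exact: orbit_map_continuous.
Qed.

Lemma lambda_locally_trivial : locally_trivial (lambda_bundle A V).
Proof.
move=> b; have [_ /(_ b)[U [phi [psi [oU Ub [cphi cpsi phiK psiK] phiE]]]]] := A_principal.
pose co e := V ((phi e).2^-1, 1)%g.
(* This equivariance makes [co e *m v] constant on the orbit of [(e, v)]. *)
have coE p e : U (orbit_map A e) -> co (A (p, 1%g) e) *m V (p, 1%g) = co e.
  move=> Ue; rewrite /co -rep_mxM (phiE e Ue).2 mulg_fst.
  by rewrite invMg mulgKV.
pose tphi (x : lambda_total A V) := (lambda_proj x, co (qrepr x).1 *m (qrepr x).2).
(* The inverse uses the point with [Pi]-coordinate 1, where [co] is the identity. *)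
pose tpsi (y : orbit_space A * 'cV[R]_d) : lambda_total A V := Q (psi (y.1, 1%g), y.2).
(* [tphi] is defined through a chosen representative; over [U] any other one gives the same
   value. *)
have tphiE e v : U (orbit_map A e) -> tphi (Q (e, v)) = (orbit_map A e, co e *m v).
  move=> Ue; rewrite /tphi lambda_projE.
  have /orbit_mapP[p] := repr_orbit_map (Q (e, v)).
  case: (qrepr _) => e' v' [/= pe pv]; rewrite -pv -pe mulmxA coE //.
  by move: Ue; rewrite -pe orbit_map_act.
have psiE b' p : U b' -> U (orbit_map A (psi (b', p))) /\ phi (psi (b', p)) = (b', p).
  by move=> Ub'; exact: (psiK (b', p)).
have psi_orbit b' p : U b' -> orbit_map A (psi (b', p)) = b'.
  by move=> Ub'; have [Up pE] := psiE b' p Ub'; rewrite -(phiE _ Up).1 pE.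
exists U, d, tphi, tpsi; split=> //.
- have oUT : open (U `*` [set: 'cV[R]_d]) by exact: open_setXT.
  have oUP : open (U `*` [set: Pi]) by exact: open_setXT.
  have oU' : open (orbit_map A @^-1` U).
    by apply: open_comp => // x _; exact: orbit_map_continuous.
  have oU2 : open (@lambda_proj _ _ _ _ A _ V @^-1` U).
    by apply: open_comp => // x _; exact: lambda_proj_continuous.
  rewrite continuous_open_subspace // in cphi.
  rewrite continuous_open_subspace // in cpsi.
  split.
  + rewrite continuous_open_subspace // => x /set_mem /=.
    rewrite -(repr_orbit_map x); case: (qrepr x) => e v; rewrite lambda_projE => Ue.
    apply: (cvg_orbit_space diag_action_continuous).
    rewrite -[orbit_map _ (e, v)]/(Q (e, v)) tphiE //; set z0 := (e, v).
    have c1 : z.1 @[z --> z0] --> e by exact: cvg_fst.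
    have c2 : z.2 @[z --> z0] --> v by exact: cvg_snd.
    have cq : orbit_map A z.1 @[z --> z0] --> orbit_map A e.
      exact: (cvg_comp _ _ c1 (@orbit_map_continuous _ _ _ A e)).
    have cph : phi z.1 @[z --> z0] --> phi e.
      exact: (cvg_comp _ _ c1 (cphi e (mem_set Ue))).
    have cph2 : (phi z.1).2 @[z --> z0] --> (phi e).2.
      exact: (cvg_comp _ _ cph cvg_snd).
    have cV : ((phi z.1).2^-1)%g @[z --> z0] --> ((phi e).2^-1)%g.
      exact: (cvg_comp _ _ cph2 (@invg_continuous Pi _)).
    apply: cvg_trans (cvg_pair_nbhs cq (cvg_rep cV c2)).
    (* [tphiE] is available only over [U], so the two functions are compared near [z0]. *)
    have nU : \forall z \near z0, U (orbit_map A z.1).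
      exact: (cq _ (open_nbhs_nbhs (conj oU Ue))).
    apply: near_eq_cvg; apply: filterS nU => -[e' v'] Ue'; exact: (esym (tphiE _ _ Ue')).
  + rewrite continuous_open_subspace // => z0 /set_mem /= [Ub' _].
    have c1 : z.1 @[z --> z0] --> z0.1 by exact: cvg_fst.
    have c2 : z.2 @[z --> z0] --> z0.2 by exact: cvg_snd.
    have cb : (z.1, 1%g : Pi) @[z --> z0] --> (z0.1, 1%g : Pi).
      by apply: (cvg_pair_nbhs c1); exact: cvg_cst.
    have cps : psi (z.1, 1%g) @[z --> z0] --> psi (z0.1, 1%g).
      by apply: (cvg_comp _ _ cb (cpsi (z0.1, 1%g) _)); exact: mem_set.
    apply: (cvg_comp _ _ (cvg_pair_nbhs cps c2)).
    exact: (@orbit_map_continuous _ _ _ (diag_action A V)).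
  + move=> x; rewrite -(repr_orbit_map x); case: (qrepr x) => e v /=.
    rewrite lambda_projE => Ue.
    rewrite tphiE //=; split=> //; rewrite /tpsi /=.
    (* This element moves [e] to the point of its orbit with [Pi]-coordinate 1. *)
    apply/esym/orbit_mapP; exists (phi e).2^-1%g; congr pair => /=.
    have Ue' : U (orbit_map A (A ((phi e).2^-1%g, 1%g) e)) by rewrite orbit_map_act.
    rewrite -(phiK _ Ue').2; congr psi.
    have [_ phiM] := phiE _ Ue; have [phi1 _] := phiE _ Ue'.
    by rewrite [LHS]surjective_pairing phi1 phiM orbit_map_act mulVg.
  + move=> [b' u] /= [Ub' _]; have [Up pE] := psiE b' 1%g Ub'.
    rewrite tphiE // psi_orbit // lambda_projE psi_orbit //.
    by rewrite /co pE /= invg1 -[(1, 1)%g]/(1%g : Pi * G) rep_mx1 mul1mx.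
- move=> x; rewrite -(repr_orbit_map x); case: (qrepr x) => e v /=.
  rewrite lambda_projE => Ue.
  have coQ u : co (qrepr (orbit_map (diag_action A V) (e, u))).1 *m
      (qrepr (orbit_map (diag_action A V) (e, u))).2 = co e *m u.
    exact: (congr1 snd (tphiE e u Ue)).
  split=> // [y|c]; last by rewrite lambda_scaleE lambda_projE !coQ scalemxAr.
  move=> /orbit_map_in_fiber[v' ->].
  by rewrite lambda_addE // lambda_projE !coQ mulmxDr.
Qed.

Lemma lambda_is_eqvt_vector_bundle : is_eqvt_vector_bundle (lambda_bundle A V).
Proof.
split=> /=.
- exact: lambda_proj_continuous.
- exact: lambda_locally_trivial.
- split=> g; apply: residual_action_continuous => //.
  exact: diag_action_continuous.
- move=> g x; rewrite -(repr_orbit_map x); case: (qrepr x) => e v.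
  by rewrite residual_actE !lambda_projE residual_actE.
- split=> [g x y|g c x].
    rewrite -(repr_orbit_map x); case: (qrepr x) => e v; rewrite lambda_projE.
    move=> /esym/orbit_map_in_fiber[v' ->].
    by rewrite lambda_addE // !residual_actE [RHS]lambda_addE //= /diag_act /= mulmxDr.
  rewrite -(repr_orbit_map x); case: (qrepr x) => e v.
  by rewrite lambda_scaleE !residual_actE [RHS]lambda_scaleE /= /diag_act /= scalemxAr.
Qed.

(** * The isotropy representation on a fiber over an [H]-fixed point *)

Section Fiber.
Variables (H : {group G}) (e : E).
Hypothesis e_fixed : fixed_points (residual_action A) [set` H] (orbit_map A e).

(** [(p * q^-1, 1)] also fixes [e], and [Pi] acts freely. *)
Lemma stabilizer_unique p q h : A (p, h) e = e -> A (q, h) e = e -> p = q.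
Proof.
have mulE : (p, h) = ((p * q^-1, 1) * (q, h))%g :> (Pi * G)%type.
  by congr pair; rewrite ?mulgKV ?mul1g.
rewrite mulE Defs.gactM => + qe; rewrite qe => /free/(congr1 (fun r => r * q)%g).
by rewrite mulgKV mul1g.
Qed.

(** The homomorphism theta. The default 1 is never taken on [H]. *)
Definition stabilizer_hom (h : G) : Pi := xget 1%g [set p | A (p, h) e = e].

Lemma stabilizer_homP h : h \in H -> A (stabilizer_hom h, h) e = e.
Proof.
(* That [h] fixes the orbit of [e] means that some [p] brings [(1, h) e] back to [e]. *)
move=> Hh; have := e_fixed Hh; rewrite [LHS]residual_actE => /orbit_mapP[p pe].
rewrite /stabilizer_hom; case: xgetP => [q _ //|/(_ p)] []; rewrite /= -[RHS]pe.
by rewrite -Defs.gactM; congr (A _ e); congr pair; rewrite ?mulg1 ?mul1g.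
Qed.

Lemma stabilizer_hom1 : stabilizer_hom 1%g = 1%g.
Proof.
by apply: (@stabilizer_unique _ _ 1%g); rewrite ?stabilizer_homP // [LHS]Defs.gact1.
Qed.

Lemma stabilizer_homM : {in H &, {morph stabilizer_hom : g h / (g * h)%g}}.
Proof.
move=> g h Hg Hh; apply: (@stabilizer_unique _ _ (g * h)%g).
  by rewrite stabilizer_homP ?groupM.
rewrite -[(_, _)]/((stabilizer_hom g, g) * (stabilizer_hom h, h))%g.
by rewrite Defs.gactM !stabilizer_homP.
Qed.

Lemma fiber_repr_proof : mx_repr H (fun h => V (stabilizer_hom h, h)).
Proof.
split=> [|g h Hg Hh]; first by rewrite stabilizer_hom1 [LHS]rep_mx1.
by rewrite stabilizer_homM // -rep_mxM.
Qed.
Definition fiber_repr := MxRepresentation fiber_repr_proof.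

Lemma fiber_iso_fiber_repr :
  @fiber_iso R G (lambda_bundle A V) (orbit_map A e) H d fiber_repr.
Proof.
exists (fun u => orbit_map (diag_action A V) (e, u)); split=> /= [|u v|c u|h u Hh].
(* For injectivity, an element of [Pi] relating [(e, u)] to [(e, v)] fixes [e], hence is 1. *)
- split=> [u _|u v _ _ /orbit_mapP[p [/free -> <-]]|x /orbit_map_in_fiber[v ->]] /=.
  + exact: lambda_projE.
  + by rewrite [V _]rep_mx1 mul1mx.
  + by exists v.
- by rewrite lambda_addE.
- by rewrite lambda_scaleE.
(* Applying [(theta(h), 1)] after [(1, h)] keeps the class and returns the base point to [e]. *)
- rewrite [RHS]residual_actE; apply/esym/orbit_mapP; exists (stabilizer_hom h).
  rewrite -Defs.gactM.
  have -> : ((stabilizer_hom h, 1) * (1, h))%g = (stabilizer_hom h, h) :> (Pi * G)%type.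
    by congr pair; rewrite ?mulg1 ?mul1g.
  by rewrite /= /diag_act /= stabilizer_homP.
Qed.

Variables (w : nat) (W : linear_rep R Pi w).

Lemma pullback_repr_proof : mx_repr H (fun h => W (stabilizer_hom h)).
Proof.
split=> [|g h Hg Hh]; first by rewrite stabilizer_hom1 rep_mx1.
by rewrite stabilizer_homM // -rep_mxM.
Qed.
Definition pullback_repr := MxRepresentation pullback_repr_proof.

(** The isomorphism is evaluated at [(theta(h), h)]. [mx_rsim] multiplies by its intertwiner on the
    right of the source, so [f'] serves instead of [f]. *)
Lemma fiber_repr_tensor (S : representation R [set: G]%G) :
  isomorphic_reps V (tensor_rep S W) ->
  mx_rsim fiber_repr (tensor_repr S pullback_repr).
Proof.
move=> [f [f' [ff' f'f fV]]]; have row_free_f' : row_free f' by apply/row_freeP; exists f.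
have row_free_f : row_free f by apply/row_freeP; exists f'.
exists f' => //; last first.
  move=> h Hh /=; rewrite -[S h *t _]/(tensor_rep S W (stabilizer_hom h, h)).
  by rewrite -[LHS]mul1mx -f'f -!mulmxA (mulmxA f) fV -!mulmxA ff' mulmx1.
(* The degrees agree: each row-free matrix bounds its number of rows by its number of columns. *)
have := rank_leq_col f; have := rank_leq_col f'.
rewrite (eqP row_free_f) (eqP row_free_f') => ? ?.
by apply/eqP; rewrite eqn_leq; apply/andP.
Qed.

End Fiber.

Lemma lambda_homogeneous w (W : linear_rep R Pi w) (S : representation R [set: G]%G) :
  (exists P, @regular_grading _ _ S P) ->
  isomorphic_reps V (tensor_rep S W) -> homogeneous (lambda_bundle A V).
Proof.
move=> [P gradP] V_iso; pose T := tensor_repr S (trivial_repr R [set: G]%G w).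
(* The class of [S] tensored with the trivial [R^w] depends neither on [H] nor on theta. *)
exists (RO_class T) => H b; rewrite -(repr_orbit_map b) => b_fixed.
exists d, (fiber_repr b_fixed); split; first exact: fiber_iso_fiber_repr.
have [B eB fB hB] := mx_rsim_trans (fiber_repr_tensor b_fixed V_iso)
  (tensor_repr_untwist (pullback_repr b_fixed W) gradP).
rewrite /RO_class RO_resE !res_classE; congr RO_diff; apply/class_ofP.
  (* The restriction of [T] to [H] has the same matrices as the untwisted tensor product over
     [H]. *)
  by exists B.
(* For the subtracted terms, the zero representation restricts to zero. *)
by exists 1%:M => //; rewrite ?row_free_unit ?unitmx1 // => g _; rewrite mulmx1 mul1mx.
Qed.

End LambdaBundle.

Theorem theorem1p12 (R : realType) (G : finGroupType) (Pi : topGroupType)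
    (Pi_Lie : compact_Lie_group R Pi)
    (E : topologicalType) (A : group_action (Pi * G)%type E)
    (A_universal : universal_principal_bundle R A)
    (n w d : nat)
    (W : linear_rep R Pi w) (W_cont : continuous_rep W)
    (V : linear_rep R (Pi * G)%type d) (V_cont : continuous_prod_rep V)
    (V_iso : isomorphic_reps V (tensor_rep (regular_multiple R G n) W)) :
  is_eqvt_vector_bundle (lambda_bundle A V) /\ homogeneous (lambda_bundle A V).
Proof.
have [A_principal _ _] := A_universal.
split; first exact: lambda_is_eqvt_vector_bundle.
exact: lambda_homogeneous (regular_grading_multiple R G n) V_iso.
Qed.
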